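(* Let $G$ be a finite simple $d$-regular Vizing-class-2 graph. Then \[\eta'_{p}(G)\leq \frac{(2^{\lceil \log_2 (d+1)\rceil})^2+2}{3}=\frac{(2^{\lceil \log_2 \chi'(G)\rceil})^2+2}{3}.\] In particular, if $d+1=2^n$ for some $n>0$, then $\eta'_{p}(G)\leq \frac{(d+1)^2+2}{3}=\frac{(\chi'(G))^2+2}{3}$.
   Context: A $d$-regular graph is Vizing-class-2 if its chromatic index $\chi'(G)$ equals $d+1$. For an edge $e$, $N'(e)$ is the set of edges other than $e$ sharing an endpoint with $e$. A proper additive edge coloring is a proper edge coloring $c:E(G)\to\mathbb{N}$ such that for any two edges $e_1,e_2$ sharing an endpoint, $\sum_{e\in N'(e_1)}c(e)\neq\sum_{e\in N'(e_2)}c(e)$. $\eta_p'(G)$ is the least $k$ such that $G$ has a proper additive edge coloring with labels in $\{1,\ldots,k\}$. *)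

(* Defs.v *)
From mathcomp Require Import all_boot.

Set Implicit Arguments.
Unset Strict Implicit.
Unset Printing Implicit Defensive.

Record sgraph := SGraph {
  vertex :> finType;
  adj : rel vertex;
  adj_sym : symmetric adj;
  adj_irr : irreflexive adj }.

Section Graph.
Variable G : sgraph.

Definition regular (d : nat) : Prop :=
  forall x : G, #|[set y | adj x y]| = d.

Definition edges : {set {set G}} :=
  [set e : {set G} | [exists x, exists y, adj x y && (e == [set x; y])]].

Definition edge : finType := {e : {set G} | e \in edges}.

Definition edge_adj (e1 e2 : edge) : bool :=
  (e1 != e2) && (val e1 :&: val e2 != set0).

Definition edge_nbh (e : edge) : {set edge} := [set f | edge_adj e f].

Definition proper_edge_coloring (C : eqType) (c : edge -> C) : bool :=
  [forall e1, forall e2, edge_adj e1 e2 ==> (c e1 != c e2)].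

Definition edge_colorable (k : nat) : bool :=
  [exists c : {ffun edge -> 'I_k}, proper_edge_coloring c].

Definition proper_additive_edge_coloring (c : edge -> nat) : bool :=
  proper_edge_coloring c &&
  [forall e1, forall e2, edge_adj e1 e2 ==>
    (\sum_(e in edge_nbh e1) c e != \sum_(e in edge_nbh e2) c e)].

(* The labels of such a coloring are the nonzero elements of 'I_k.+1, *)
(* that is, 1, ..., k.                                                *)
Definition additively_edge_colorable (k : nat) : bool :=
  [exists c : {ffun edge -> 'I_k.+1},
    [forall e, 0 < c e] && proper_additive_edge_coloring (fun e => c e)].

Lemma ex_edge_colorable : exists k, edge_colorable k.
Proof.
exists #|edge|; apply/existsP; exists [ffun e => enum_rank e].
apply/forallP => e1; apply/forallP => e2; apply/implyP => /andP[ne12 _].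
by rewrite !ffunE (inj_eq enum_rank_inj).
Qed.

Lemma binary_sum_inj n (a b : nat -> bool) :
  \sum_(i < n) a i * 2 ^ i = \sum_(i < n) b i * 2 ^ i ->
  forall i, i < n -> a i = b i.
Proof.
elim: n a b => [|n IHn] a b // Eab.
have shift (h : nat -> bool) :
    \sum_(i < n.+1) h i * 2 ^ i = h 0 + (\sum_(i < n) h i.+1 * 2 ^ i).*2.
  rewrite big_ord_recl muln1 -mul2n big_distrr /=; congr (_ + _).
  by apply: eq_bigr => i _; rewrite /bump /= add1n expnS mulnCA.
move: Eab; rewrite !shift => Eab.
have E0 : a 0 = b 0.
  by move/(congr1 odd): Eab; rewrite !oddD !odd_double !addbF !oddb.
move/eqP: Eab; rewrite E0 eqn_add2l => /eqP/double_inj Eab.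
by case=> [|i] // lt_i; apply: (IHn (fun i => a i.+1) (fun i => b i.+1)).
Qed.

(* Distinct powers of 2 as labels always give such a coloring: equal sums *)
(* force N'(e1) = N'(e2), but e1 is in N'(e2) and not in N'(e1).          *)
Lemma ex_additively_edge_colorable : exists k, additively_edge_colorable k.
Proof.
pose K := 2 ^ #|edge|; exists K; apply/existsP.
exists [ffun e => inord (2 ^ enum_rank e)].
have cE (e : edge) : inord (n' := K) (2 ^ enum_rank e) = 2 ^ enum_rank e :> nat.
  by rewrite inordK // ltnS leq_exp2l // ltnW.
apply/andP; split; first by apply/forallP => e; rewrite ffunE cE expn_gt0.
have sumE e1 : \sum_(e in edge_nbh e1) 2 ^ enum_rank e =
    \sum_(i < #|edge|)
      [exists e in edge_nbh e1, enum_rank e == i :> nat] * 2 ^ i.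
  rewrite big_mkcond (reindex _ (onW_bij _ (@enum_val_bij edge))) /=.
  apply: eq_bigr => i _; rewrite enum_valK.
  have -> : [exists e in edge_nbh e1, enum_rank e == i :> nat]
            = (enum_val i \in edge_nbh e1).
    apply/existsP/idP => [[e /andP[ne /eqP/val_inj <-]]|ni].
      by rewrite enum_rankK.
    by exists (enum_val i); rewrite ni enum_valK eqxx.
  by case: (_ \in _); rewrite ?mul1n.
apply/andP; split; apply/forallP => e1; apply/forallP => e2.
  apply/implyP => /andP[ne12 _]; rewrite !ffunE.
  apply: contra ne12; rewrite !cE.
  by rewrite eqn_exp2l // => /eqP/val_inj/enum_rank_inj->.
apply/implyP => adj12; apply/eqP.
under eq_bigr do rewrite ffunE cE.
under [RHS]eq_bigr do rewrite ffunE cE.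
rewrite !sumE => /(@binary_sum_inj _
  (fun i => [exists e in edge_nbh e1, enum_rank e == i :> nat])
  (fun i => [exists e in edge_nbh e2, enum_rank e == i :> nat])).
move=> /(_ (enum_rank e1) (ltn_ord _)) E.
have: [exists e in edge_nbh e2, enum_rank e == enum_rank e1 :> nat].
  apply/existsP; exists e1; rewrite eqxx andbT inE.
  by case/andP: adj12 => ne i12; rewrite /edge_adj eq_sym ne setIC.
rewrite -E => /existsP[e /andP[ne /eqP/val_inj/enum_rank_inj Ee]].
by move: ne; rewrite Ee inE /edge_adj eqxx.
Qed.

Definition chromatic_index : nat := ex_minn ex_edge_colorable.

(* eta'_p *)
Definition eta_p : nat := ex_minn ex_additively_edge_colorable.

Definition vizing_class2 (d : nat) : Prop := chromatic_index = d.+1.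

End Graph.

(* Main.v *)
Require Import Defs.
From mathcomp Require Import all_boot all_order all_algebra.
From mathcomp Require Import zify.
Import Order.TTheory GRing.Theory Num.Theory.
Local Open Scope ring_scope.

Set Implicit Arguments.
Unset Strict Implicit.

(** In a proper edge coloring with d + 1 colors of a d-regular graph, every
    vertex [u] misses exactly one color [m u]. Relabel the colors by a weight
    [w] and let [T] be the sum of all weights. The sum over the neighborhood of
    an edge [uv] of color [b] is
    [(T - w (m u)) + (T - w (m v)) - 2 * w b], so two adjacent edges [uv], [uv']
    of colors [b], [b'] have equal sums iff
    [w (m v) + 2 * w b = w (m v') + 2 * w b']. If every number has at most one
    representation [w a + 2 * w b], this forces [b = b'], a contradiction. Sums
    of distinct powers of 4 (the Moser-de Bruijn sequence), shifted by 1 to be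
    positive, have this property, and the first [2 ^ k] of them are at most
    [(4 ^ k + 2) / 3]. *)

Local Open Scope nat_scope.

(* The [k] low binary digits of [n], read in base 4. *)
Fixpoint moser (k n : nat) : nat :=
  if k is k'.+1 then odd n + 4 * moser k' n./2 else 0.

(** The extreme case has all digits 1, where the geometric sum is [(4 ^ k - 1) / 3]; the successor
    is the shift that makes labels positive. *)
Lemma moser_bound k n : 3 * (moser k n).+1 <= 4 ^ k + 2.
Proof.
by elim: k n => [|k IHk] n //=; have := IHk n./2; rewrite expnS; lia.
Qed.

(** The base 4 digits of [moser k a + 2 * moser k b] are [a_i + 2 * b_i <= 3], so nothing carries
    and each digit reveals both bits. *)
Lemma moser_double_inj k a b a' b' :
    a < 2 ^ k -> b < 2 ^ k -> a' < 2 ^ k -> b' < 2 ^ k ->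
  moser k a + 2 * moser k b = moser k a' + 2 * moser k b' ->
  a = a' /\ b = b'.
Proof.
elim: k a b a' b' => [|k IHk] a b a' b' /=; first by rewrite expn0; lia.
rewrite expnS => lt_a lt_b lt_a' lt_b' E.
have [|||||Ea Eb] := IHk a./2 b./2 a'./2 b'./2; lia.
Qed.

Section IncidenceSums.
Variable G : sgraph.
Implicit Types (u v : G) (e f : edge G).

Definition incident u : {set edge G} := [set e : edge G | u \in val e].

Lemma edge_endpoints e u : u \in val e -> exists v, val e = [set u; v].
Proof.
have := valP e; rewrite inE => /existsP[x /existsP[y /andP[_ /eqP ->]]].
by rewrite !inE => /orP[]/eqP->; [exists y | exists x; rewrite setUC].
Qed.

Lemma edge_endpoints_adj e u v : val e = [set u; v] -> adj u v.
Proof.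
move=> Ee; have := valP e; rewrite inE.
move=> /existsP[x /existsP[y /andP[xy /eqP]]].
rewrite Ee => E; have ney : x != y by apply: contraTneq xy => ->; rewrite adj_irr.
have: u \in [set x; y] by rewrite -E set21.
have: v \in [set x; y] by rewrite -E set22.
have: x \in [set u; v] by rewrite E set21.
have: y \in [set u; v] by rewrite E set22.
rewrite !inE => yuv xuv /orP[]/eqP Ev /orP[]/eqP Eu; subst u v => //.
- by move: yuv; rewrite orbb eq_sym (negPf ney).
- by rewrite adj_sym.
- by move: xuv; rewrite orbb (negPf ney).
Qed.

Lemma edge_endpoints_neq e u v : val e = [set u; v] -> u != v.
Proof.
by move=> /edge_endpoints_adj; apply: contraTneq => ->; rewrite adj_irr.
Qed.

Lemma card_incident u : #|incident u| = #|[set y | adj u y]|.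
Proof.
rewrite -(card_imset _ val_inj).
have -> : [set val e | e in incident u] =
          [set [set u; y] | y in [set y | adj u y]].
  apply/setP => A; apply/imsetP/imsetP => [[e]|[y]].
    rewrite inE => /edge_endpoints[v Ev] ->; exists v => //.
    by rewrite inE (edge_endpoints_adj Ev).
  rewrite inE => uy ->.
  have Euy : [set u; y] \in edges G.
    by rewrite inE; apply/existsP; exists u; apply/existsP; exists y; rewrite uy /=.
  by exists (Sub [set u; y] Euy : edge G); rewrite ?SubK // inE SubK set21.
apply: card_in_imset => y z; rewrite !inE => uy uz E.
have: y \in [set u; z] by rewrite -E set22.
rewrite !inE => /orP[/eqP Ey|/eqP //].
by move: uy; rewrite Ey adj_irr.
Qed.

(** The right side counts [e] once at each endpoint; adding [2 * c e] on the left avoids truncated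
    subtraction. *)
Lemma sum_edge_nbh (c : edge G -> nat) e u v : val e = [set u; v] ->
  \sum_(f in edge_nbh e) c f + 2 * c e =
  \sum_(f in incident u) c f + \sum_(f in incident v) c f.
Proof.
move=> Ee; have neuv := edge_endpoints_neq Ee.
have eu : e \in incident u by rewrite inE Ee set21.
have ev : e \in incident v by rewrite inE Ee set22.
rewrite (big_setD1 _ eu) (big_setD1 _ ev) /=.
have -> : edge_nbh e = (incident u :\ e) :|: (incident v :\ e).
  apply/setP => f; rewrite !inE /edge_adj Ee eq_sym -andb_orr; congr (_ && _).
  apply/set0Pn/orP => [[x]|[uf|vf]].
  - by rewrite !inE => /andP[/orP[]/eqP-> ?]; [left | right].
  - by exists u; rewrite !inE eqxx.
  - by exists v; rewrite !inE eqxx orbT.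
rewrite (eq_bigl _ _ (fun f => in_setU f _ _)) bigU /=; first by lia.
(* Disjointness: an edge through both [u] and [v] is [e] itself. *)
rewrite -setI_eq0; apply/eqP/setP => f; rewrite !inE.
apply/negP => /andP[/andP[/eqP nef uf] /andP[_ vf]]; case: nef.
apply: val_inj; have [z Ef] := edge_endpoints uf.
by move: vf; rewrite Ee Ef !inE eq_sym (negPf neuv) => /eqP->.
Qed.

End IncidenceSums.

Section WeightedColoring.
Variables (G : sgraph) (d : nat).
Hypothesis Greg : regular G d.
Variable c : edge G -> 'I_d.+1.
Hypothesis c_proper : proper_edge_coloring c.
Variable w : 'I_d.+1 -> nat.

Lemma proper_coloringP e1 e2 : edge_adj e1 e2 -> c e1 != c e2.
Proof. by move/forallP: c_proper => /(_ e1)/forallP/(_ e2)/implyP. Qed.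

Lemma coloring_inj_incident (u : G) : {in incident u &, injective c}.
Proof.
move=> e f; rewrite !inE => ue uf Ec; apply/eqP; apply: contra_eqT Ec => nef.
apply: proper_coloringP; rewrite /edge_adj nef.
by apply/set0Pn; exists u; rewrite inE ue.
Qed.

Lemma sum_incident_missing (u : G) :
  exists m, \sum_(e in incident u) w (c e) + w m = \sum_j w j.
Proof.
(* The [d] edges at [u] carry [d] distinct colors out of [d.+1]. *)
have /eqP/cards1P[m Em] : #|~: (c @: incident u)| = 1.
  rewrite cardsCs setCK card_ord (card_in_imset (@coloring_inj_incident u)).
  by rewrite card_incident Greg subSnn.
exists m; rewrite (bigID (mem (c @: incident u))) /=.
rewrite (big_imset _ (@coloring_inj_incident u)) /=; congr (_ + _).
rewrite (big_pred1 m) // => j.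
by have /setP/(_ j) := Em; rewrite !inE.
Qed.

Hypothesis w_double_inj :
  forall a b a' b', w a + 2 * w b = w a' + 2 * w b' -> b = b'.

Lemma weighted_coloring_additive :
  proper_additive_edge_coloring (fun e => w (c e)).
Proof.
apply/andP; split; apply/forallP => e1; apply/forallP => e2;
  apply/implyP => e12.
  apply: contra (proper_coloringP e12) => /eqP Ew.
  (* Equal first terms, here both [w ord0], turn the hypothesis into injectivity of [w]. *)
  by apply/eqP/(@w_double_inj ord0 _ ord0); rewrite Ew.
apply: contra (proper_coloringP e12) => /eqP Es.
have /andP[_ /set0Pn[u]] := e12; rewrite inE.
move=> /andP[/edge_endpoints[v1 E1] /edge_endpoints[v2 E2]].
have := sum_edge_nbh (fun e => w (c e)) E1.
have := sum_edge_nbh (fun e => w (c e)) E2.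
(* The sum at the common endpoint [u] cancels, so only the colors missing at [v1] and [v2]
   matter. *)
have [m1 M1] := sum_incident_missing v1.
have [m2 M2] := sum_incident_missing v2.
move=> S2 S1; apply/eqP/(@w_double_inj m1 _ m2).
move: Es S1 S2 M1 M2 => /=; lia.
Qed.

End WeightedColoring.

Lemma edge_colorable_chromatic_index (G : sgraph) :
  edge_colorable G (chromatic_index G).
Proof. by rewrite /chromatic_index; case: ex_minnP. Qed.

Lemma eta_p_le (G : sgraph) k : additively_edge_colorable G k -> eta_p G <= k.
Proof. by rewrite /eta_p; case: ex_minnP => m _ min_m /min_m. Qed.

Lemma additively_edge_colorableI (G : sgraph) k (c : edge G -> nat) :
    (forall e, 0 < c e <= k) -> proper_additive_edge_coloring c ->
  additively_edge_colorable G k.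
Proof.
move=> c_range /andP[/forallP c_prop /forallP c_add].
pose c' := [ffun e => inord (c e) : 'I_k.+1]; apply/existsP; exists c'.
(* [inord] keeps the label, since [c e <= k] rules out its default value. *)
have c'E e : c' e = c e :> nat.
  by rewrite ffunE inordK // ltnS; case/andP: (c_range e).
apply/andP; split.
  by apply/forallP => e; rewrite c'E; case/andP: (c_range e).
apply/andP; split; apply/forallP => e1; apply/forallP => e2.
  by rewrite !c'E; have /forallP := c_prop e1; apply.
under eq_bigr do rewrite c'E.
under [X in _ != X]eq_bigr do rewrite c'E.
by have /forallP := c_add e1; apply.
Qed.

Lemma eta_p_bound (G : sgraph) d k :
    regular G d -> edge_colorable G d.+1 -> d < 2 ^ k ->
  3 * eta_p G <= (2 ^ k) ^ 2 + 2.
Proof.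
move=> Greg /existsP[c c_proper] lt_d.
have lt_ord (j : 'I_d.+1) : j < 2 ^ k by apply: leq_trans (ltn_ord j) lt_d.
(* The largest label allowed becomes the natural number [(4 ^ k + 2) %/ 3]. *)
rewrite expnAC -[2 ^ 2]/4 mulnC -leq_divRL //; apply: eta_p_le.
apply: (@additively_edge_colorableI _ _ (fun e => (moser k (c e)).+1)).
  by move=> e; rewrite leq_divRL // mulnC moser_bound.
apply: (weighted_coloring_additive Greg c_proper
  (w := fun j => (moser k j).+1)) => a b a' b' E.
apply: val_inj; suff [] : a = a' :> nat /\ b = b' :> nat by [].
(* The shift by 1 adds 3 to both sides of [E] and cancels. *)
by apply: (@moser_double_inj k) => //; move: E; lia.
Qed.

Local Open Scope ring_scope.
Unset Implicit Arguments.

Theorem theorem2p4 (G : sgraph) (d : nat)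
  (Greg : regular G d) (Gclass2 : vizing_class2 G d) :
  [/\ (eta_p G)%:R <= ((2 ^+ up_log 2 d.+1) ^+ 2 + 2) / 3 :> rat,
      ((2 ^+ up_log 2 d.+1) ^+ 2 + 2) / 3
        = ((2 ^+ up_log 2 (chromatic_index G)) ^+ 2 + 2) / 3 :> rat
    & forall n : nat, (0 < n)%N -> d.+1 = (2 ^ n)%N ->
        (eta_p G)%:R <= (d.+1%:R ^+ 2 + 2) / 3 :> rat /\
        (d.+1%:R ^+ 2 + 2) / 3
          = ((chromatic_index G)%:R ^+ 2 + 2) / 3 :> rat].
Proof.
have bound k : (d < 2 ^ k)%N ->
    (eta_p G)%:R <= ((2 ^+ k) ^+ 2 + 2) / 3 :> rat.
  have colG : edge_colorable G d.+1.
    by rewrite -Gclass2 edge_colorable_chromatic_index.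
  move=> /(eta_p_bound Greg colG).
  rewrite -(ler_nat rat) natrM natrD !natrX => le_eta.
  by rewrite ler_pdivlMr ?ltr0n // mulrC.
(* [bound] is used with [k] the rounded-up logarithm, then with [k = n]. *)
rewrite Gclass2; split=> // [|n _ Ed]; first exact/bound/up_logP.
by split=> //; rewrite Ed natrX; apply: bound; rewrite -Ed.
Qed.
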